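(* Let $\{\eta_n\}_{n\ge1}$ be real random variables, $\eta_n$ defined on a probability space $\Omega_n$, and let $\{\phi_{n,x}\}_{n\ge1,x\in\mathbb R}$ be real random variables with $\phi_{n,x}$ defined on $\Omega_n$. Assume: (1) $0\le\phi_{n,x}\le\phi_{n,y}\le1$ for all $n\ge1$ and $x\le y$; (2) for every $\varepsilon>0$ there is $M>0$ such that for all $n$, $x\in\mathbb R$ and $\omega\in\Omega_n$ with $\eta_n(\omega)-x>M$ we have $\phi_{n,x}(\omega)<\varepsilon$; (3) for every $\varepsilon>0$ there is $M>0$ such that for all $n$, $x\in\mathbb R$ and $\omega\in\Omega_n$ with $\eta_n(\omega)-x<-M$ we have $\phi_{n,x}(\omega)>1-\varepsilon$; (4) there is a constant $c>0$ independent of $n$ such that for all $n$, $x\in\mathbb R$ and $\omega\in\Omega_n$ with $x<\eta_n(\omega)\le x+1$ we have $\phi_{n,x+1}(\omega)-\phi_{n,x}(\omega)\ge c$. Then the sequence of random variables $\{\eta_n\}_{n\ge1}$ and the sequence of non-decreasing functions $\{F_n(x):=\mathbb E\,\phi_{n,x}\}_{n\ge1}$ are asymptotically equivalent.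
   Context: A sequence $\{\eta_n\}_{n\ge1}$ of real random variables spreads if $\lim_{n\to\infty}\sup_{x\in\mathbb R}\mathrm{Prob}\{x<\eta_n\le x+1\}=0$. A sequence $\{F_n\}_{n\ge1}$ of non-decreasing functions $\mathbb R\to\mathbb R$ spreads if $\lim_{n\to\infty}\sup_{x\in\mathbb R}(F_n(x+1)-F_n(x))=0$. A sequence of real random variables $\{\eta_n\}$ and a sequence of non-decreasing functions $\{F_n\}$ are asymptotically equivalent if (i) $\{\eta_n\}$ spreads if and only if $\{F_n\}$ spreads, and (ii) when both spread, $\lim_{n\to\infty}\sup_{x\in\mathbb R}(\mathrm{Prob}\{\eta_n\le x\}-F_n(x))=0$. Two sequences of real random variables $\{\eta_n\},\{\zeta_n\}$ are asymptotically equivalent if $\{\eta_n\}$ spreads iff $\{\zeta_n\}$ spreads, and when both spread $\lim_{n\to\infty}\sup_x(\mathrm{Prob}\{\eta_n\le x\}-\mathrm{Prob}\{\zeta_n\le x\})=0$. The same notions apply to families indexed by other index sets with a limit point in place of $n\to\infty$. *)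

(* Defs.v *)
From HB Require Import structures.
From mathcomp Require Import all_boot all_order all_algebra.
From mathcomp Require Import all_classical all_reals all_analysis.
Set Implicit Arguments. Unset Strict Implicit. Unset Printing Implicit Defensive.
Import Order.TTheory GRing.Theory Num.Theory.
Import numFieldNormedType.Exports.
Local Open Scope classical_set_scope.
Local Open Scope ring_scope.

Definition spreads_rv (R : realType) (d : nat -> measure_display)
  (T : forall n, measurableType (d n)) (P : forall n, probability (T n) R)
  (eta : forall n, T n -> R) : Prop :=
  (fun n => ereal_sup (range (fun x : R =>
      P n [set w | x < eta n w <= x + 1])))
    @ \oo --> (0 : \bar R).

Definition spreads_fun (R : realType) (F : nat -> R -> R) : Prop :=
  (fun n => ereal_sup (range (fun x : R => ((F n (x + 1) - F n x)%:E))))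
    @ \oo --> (0 : \bar R).

Definition asymp_equiv_rv_fun (R : realType) (d : nat -> measure_display)
  (T : forall n, measurableType (d n)) (P : forall n, probability (T n) R)
  (eta : forall n, T n -> R) (F : nat -> R -> R) : Prop :=
  (spreads_rv P eta <-> spreads_fun F) /\
  (spreads_rv P eta -> spreads_fun F ->
    (fun n => ereal_sup (range (fun x : R =>
        (P n [set w | (eta n w <= x)%R] - (F n x)%:E)%E)))
      @ \oo --> (0 : \bar R)).

(* Main.v *)
(* Write S_n = sup_x P(x < eta_n <= x + 1) and D_n = sup_x (F_n(x+1) - F_n(x)).
   Integrating hypothesis (4) over the window x < eta_n <= x + 1 gives
   c S_n <= D_n.  Conversely, (2) and (3) give N such that
   phi_{n,x+1} <= phi_{n,x} + eps unless x - N < eta_n <= x + N, a window covered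
   by 2N unit windows, so D_n <= eps + 2N S_n.  In the same way
   1{eta_n <= x} <= phi_{n,x} + eps + 1{x - N < eta_n <= x}, hence
   sup_x (P(eta_n <= x) - F_n(x)) <= eps + N S_n, while evaluating at an x far
   to the left of a point where the cdf of eta_n is small shows that this
   supremum is at least -eps. *)

Require Import Defs.
From HB Require Import structures.
From mathcomp Require Import all_boot all_order all_algebra.
From mathcomp Require Import all_classical all_reals all_analysis.
From mathcomp Require Import measurable_realfun lra.

Import Order.TTheory GRing.Theory Num.Theory.
Import numFieldNormedType.Exports.
Local Open Scope classical_set_scope.
Local Open Scope ring_scope.

Lemma ge0_le1_fin_num {R : realType} {x : \bar R} :
  (0 <= x)%E -> (x <= 1)%E -> x \is a fin_num.
Proof. by move=> x0 x1; rewrite ge0_fin_numE // (le_lt_trans x1) ?ltry. Qed.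

Lemma indic_ge0 {T : Type} {R : realType} (A : set T) (w : T) :
  0 <= \1_A w :> R.
Proof. by rewrite indicE. Qed.

Lemma indic_le1 {T : Type} {R : realType} (A : set T) (w : T) :
  \1_A w <= 1 :> R.
Proof. by rewrite indicE; case: (w \in A). Qed.

Lemma cvge0_eps_dominated {R : realType} {u : nat -> \bar R} {v : nat -> R} :
  v @ \oo --> 0 ->
  (forall e : R, 0 < e -> exists K : R, 0 <= K /\
     forall n, ((- e)%:E <= u n /\ u n <= (e + K * v n)%:E)%E) ->
  u @ \oo --> 0%E.
Proof.
move=> v0 ubound.
have u_fin n : u n \is a fin_num.
  have [K [_ /(_ n) [lo hi]]] := ubound 1 ltr01.
  by rewrite fin_numElt (lt_le_trans _ lo) ?ltNyr // (le_lt_trans hi) ?ltry.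
apply: cvg_EFin; first exact: nearW.
apply/cvgrPdist_le => e e0.
have e20 : 0 < e / 2 by rewrite divr_gt0.
have [K [K0 uK]] := ubound _ e20.
have eK0 : 0 < e / 2 / (K + 1) by rewrite divr_gt0 // ltr_wpDl.
move/cvgrPdist_le : v0 => /(_ _ eK0); apply: filterS => n.
rewrite /= !sub0r !normrN => vn.
have [lo hi] := uK n; rewrite -(fineK (u_fin n)) !lee_fin in lo hi.
have Kv : K * v n <= e / 2.
  apply: (@le_trans _ _ (K * (e / 2 / (K + 1)))).
    by apply: ler_wpM2l => //; exact: le_trans (ler_norm _) vn.
  rewrite mulrA ler_pdivrMr ?ltr_wpDl //; nra.
by rewrite ler_norml; apply/andP; split; lra.
Qed.

Section probability_bounds.
Context {d : measure_display} {T : measurableType d} {R : realType}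
  (P : probability T R).
Local Open Scope ereal_scope.

Lemma ge0_expectationD {f g : T -> R} :
  measurable_fun setT f -> measurable_fun setT g ->
  (forall w, (0 <= f w)%R) -> (forall w, (0 <= g w)%R) ->
  'E_P[f \+ g] = 'E_P[f] + 'E_P[g].
Proof.
move=> mf mg f0 g0; rewrite unlock.
under eq_integral do rewrite /= EFinD.
apply: ge0_integralD => //.
- by move=> w _; rewrite lee_fin.
- exact/measurable_EFinP.
- by move=> w _; rewrite lee_fin.
- exact/measurable_EFinP.
Qed.

Lemma expectationZ_indic {A : set T} {c : R} : measurable A -> (0 <= c)%R ->
  'E_P[fun w => (c * \1_A w)%R] = c%:E * P A.
Proof.
move=> mA c0; rewrite unlock.
rewrite (@integralZl_indic _ _ _ P setT measurableT (fun _ => A)) //.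
  by rewrite integral_indic // setIT.
by move=> /lt_le_trans/(_ c0); rewrite ltxx.
Qed.

Lemma expectation_ge0_le1 {f : T -> R} : measurable_fun setT f ->
  (forall w, 0 <= f w <= 1)%R -> 0 <= 'E_P[f] /\ 'E_P[f] <= 1.
Proof.
move=> mf f01; split.
  by apply: expectation_ge0 => w; case/andP: (f01 w).
rewrite -(expectation_cst P 1); apply: expectation_le => //.
- by move=> w; case/andP: (f01 w).
- by apply: aeW => w; case/andP: (f01 w).
Qed.

Lemma expectation_le_cst_indic {f g : T -> R} {e : R} {A : set T} :
  measurable_fun setT f -> measurable_fun setT g -> measurable A ->
  (forall w, 0 <= f w)%R -> (forall w, 0 <= g w)%R -> (0 <= e)%R ->
  (forall w, f w <= g w + e + \1_A w)%R ->
  'E_P[f] <= 'E_P[g] + e%:E + P A.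
Proof.
move=> mf mg mA f0 g0 e0 fle.
have mi : measurable_fun setT (\1_A : T -> R) := measurable_indic mA.
rewrite -(expectation_cst P e) -(expectation_indic P mA).
have mge : measurable_fun setT (g \+ cst e)%R by exact: measurable_funD.
have ge0 w : (0 <= (g \+ cst e)%R w)%R by rewrite addr_ge0.
rewrite -ge0_expectationD // -ge0_expectationD //.
apply: expectation_le => //.
- exact: measurable_funD.
- by move=> w; apply: addr_ge0; [exact: ge0 | exact: indic_ge0].
- exact: aeW.
Qed.

Lemma expectation_ge_indicZ {f g : T -> R} {c : R} {A : set T} :
  measurable_fun setT f -> measurable_fun setT g -> measurable A ->
  (forall w, 0 <= g w)%R -> (0 <= c)%R ->
  (forall w, g w + c * \1_A w <= f w)%R ->
  'E_P[g] + c%:E * P A <= 'E_P[f].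
Proof.
move=> mf mg mA g0 c0 gle.
have mcA : measurable_fun setT (fun w => (c * \1_A w)%R).
  exact: measurable_funM (measurable_indic mA).
have cA0 w : (0 <= c * \1_A w)%R by rewrite mulr_ge0 // indic_ge0.
rewrite -expectationZ_indic // -ge0_expectationD //.
apply: expectation_le => //; last exact: aeW.
- exact: measurable_funD.
- by move=> w /=; rewrite addr_ge0.
- by move=> w; apply: le_trans (gle w); rewrite addr_ge0.
Qed.

Lemma measurable_RV_le (X : {RV P >-> R}) (a : R) :
  measurable [set w | (X w <= a)%R].
Proof.
have -> : [set w | (X w <= a)%R] = X @^-1` `]-oo, a].
  by apply/seteqP; split => w; rewrite /= in_itv.
exact: measurable_funPTI (measurable_itv _).
Qed.

Lemma measurable_RV_window (X : {RV P >-> R}) (a b : R) :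
  measurable [set w | (a < X w <= b)%R].
Proof.
have -> : [set w | (a < X w <= b)%R] = X @^-1` `]a, b].
  by apply/seteqP; split => w; rewrite /= in_itv.
exact: measurable_funPTI (measurable_itv _).
Qed.

Lemma exists_cdf_le (X : {RV P >-> R}) {e : R} : (0 < e)%R ->
  exists y, P [set w | (X w <= y)%R] <= e%:E.
Proof.
move=> e0; have /fine_cvgP[_] := cvg_cdfNy0 X.
move=> /cvgrPdist_lt/(_ e e0) [M [_ cdfM]].
exists (M - 1)%R; have := cdfM (M - 1)%R ltac:(lra).
rewrite /= sub0r normrN.
have -> : cdf X (M - 1)%R = P [set w | (X w <= M - 1)%R] by [].
rewrite -[X in X <= _]fineK ?fin_num_measure ?lee_fin //.
  by move=> /(le_lt_trans (ler_norm _))/ltW.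
exact: measurable_RV_le.
Qed.

End probability_bounds.

Section spreading.
Context {R : realType} {d : nat -> measure_display}
  {T : forall n, measurableType (d n)} {P : forall n, probability (T n) R}
  {eta : forall n, {RV (P n) >-> R}} {phi : forall n, R -> {RV (P n) >-> R}}.
Hypothesis phi_mono : forall n (x y : R) (w : T n), x <= y ->
  0 <= phi n x w /\ phi n x w <= phi n y w /\ phi n y w <= 1.
Hypothesis phi_right_tail : forall eps : R, 0 < eps -> exists M : R, 0 < M /\
  forall n (x : R) (w : T n), eta n w - x > M -> phi n x w < eps.
Hypothesis phi_left_tail : forall eps : R, 0 < eps -> exists M : R, 0 < M /\
  forall n (x : R) (w : T n), eta n w - x < - M -> phi n x w > 1 - eps.

Definition expected_phi n x := fine ('E_(P n)[phi n x])%E.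

Definition window n (a b : R) := [set w : T n | a < eta n w <= b].

Definition window_sup n :=
  ereal_sup (range (fun x => P n (window n x (x + 1)))).

Definition increment_sup n :=
  ereal_sup (range (fun x => (expected_phi n (x + 1) - expected_phi n x)%:E)).

Definition cdf_gap_sup n :=
  ereal_sup (range (fun x =>
    (P n [set w | (eta n w <= x)%R] - (expected_phi n x)%:E)%E)).

Lemma phi_ge0_le1 n x : forall w, 0 <= phi n x w <= 1.
Proof. by move=> w; have [? [_ ?]] := phi_mono n x x w (lexx x); apply/andP. Qed.

Lemma phi_ge0 n x : forall w, 0 <= phi n x w.
Proof. by move=> w; case/andP: (phi_ge0_le1 n x w). Qed.

Lemma measurable_phi n x : measurable_fun setT (phi n x).
Proof. exact: measurable_funPT. Qed.

Lemma expected_phiE n x : ('E_(P n)[phi n x] = (expected_phi n x)%:E)%E.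
Proof.
have [E0 E1] := expectation_ge0_le1 (P n) (measurable_phi n x) (phi_ge0_le1 n x).
by rewrite fineK // ge0_le1_fin_num.
Qed.

Lemma expected_phi_ge0_le1 n x : 0 <= expected_phi n x <= 1.
Proof.
have [] := expectation_ge0_le1 (P n) (measurable_phi n x) (phi_ge0_le1 n x).
by rewrite expected_phiE !lee_fin => -> ->.
Qed.

Lemma expected_phi_nondecreasing n : {homo expected_phi n : x y / x <= y}.
Proof.
move=> x y xy; rewrite -lee_fin -!expected_phiE.
apply: expectation_le; try exact: measurable_phi; try exact: phi_ge0.
by apply: aeW => w; have [_ []] := phi_mono n x y w xy.
Qed.

Lemma measurable_window n a b : measurable (window n a b).
Proof. exact: measurable_RV_window. Qed.

Lemma prob_window_le_window_sup n x : (P n (window n x (x + 1)) <= window_sup n)%E.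
Proof. by apply: ereal_sup_ubound; exists x. Qed.

Lemma window_sup_ge0_le1 n : (0 <= window_sup n)%E /\ (window_sup n <= 1)%E.
Proof.
split; first exact: le_trans (measure_ge0 _ _) (prob_window_le_window_sup n 0).
by apply/ereal_supP => _ [x _ <-]; exact: probability_le1 (measurable_window _ _ _).
Qed.

Lemma window_supE n : window_sup n = (fine (window_sup n))%:E.
Proof. by have [? ?] := window_sup_ge0_le1 n; rewrite fineK // ge0_le1_fin_num. Qed.

Lemma increment_sup_ge0_le1 n :
  (0 <= increment_sup n)%E /\ (increment_sup n <= 1)%E.
Proof.
split.
  apply: le_trans (ereal_sup_ubound (ex_intro2 _ _ 0 I erefl)).
  by rewrite /= lee_fin subr_ge0 expected_phi_nondecreasing // lerDl.
apply/ereal_supP => _ [x _ <-]; rewrite lee_fin.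
by have := expected_phi_ge0_le1 n (x + 1); have := expected_phi_ge0_le1 n x; lra.
Qed.

Lemma increment_supE n : increment_sup n = (fine (increment_sup n))%:E.
Proof. by have [? ?] := increment_sup_ge0_le1 n; rewrite fineK // ge0_le1_fin_num. Qed.

Lemma prob_window_le_nat n (a : R) k :
  (P n (window n a (a + k%:R)) <= (k%:R * fine (window_sup n))%:E)%E.
Proof.
elim: k => [|k IH].
  rewrite mul0r addr0 (_ : window n a a = set0) ?measure0 //.
  by apply/seteqP; split => w //= /andP[/lt_le_trans h /h]; rewrite ltxx.
apply: le_trans (_ : P n (window n a (a + k%:R) `|`
                          window n (a + k%:R) (a + k%:R + 1)) <= _)%E.
  apply: le_measure; rewrite ?inE.
  - exact: measurable_window.
  - by apply: measurableU; exact: measurable_window.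
  move=> w /= /andP[aw wk].
  have [h|h] := leP (eta n w) (a + k%:R); [left|right]; apply/andP; split => //.
  by rewrite -addrA natr1.
apply: le_trans (measureU2 _ (measurable_window _ _ _) (measurable_window _ _ _)) _.
rewrite -natr1 mulrDl mul1r EFinD leeD // -window_supE.
exact: prob_window_le_window_sup.
Qed.

Lemma phi_tails_nat {eps : R} : 0 < eps -> exists N : nat,
  (forall n x w, x + N%:R < eta n w -> phi n (x + 1) w < eps) /\
  (forall n x w, eta n w <= x - N%:R -> 1 - eps < phi n x w).
Proof.
move=> eps0.
have [M [M0 rtail]] := phi_right_tail eps eps0.
have [L [L0 ltail]] := phi_left_tail eps eps0.
have ML : 0 <= M + L + 1 by lra.
have := archi_boundP ML; set N := Num.bound _ => MLN.
by exists N; split => n x w h; [apply: rtail | apply: ltail]; lra.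
Qed.

Lemma increment_sup_le_window_sup {eps : R} : 0 < eps -> exists K : R, 0 <= K /\
  forall n, (increment_sup n <= (eps + K * fine (window_sup n))%:E)%E.
Proof.
move=> eps0; have [N [rtail ltail]] := phi_tails_nat eps0.
exists (N + N)%:R; split => // n; apply/ereal_supP => _ [x _ <-].
set A := window n (x - N%:R) (x - N%:R + (N + N)%:R).
have phi_le w : phi n (x + 1) w <= phi n x w + eps + \1_A w.
  case/andP: (phi_ge0_le1 n x w) => ? ?; case/andP: (phi_ge0_le1 n (x + 1) w) => ? ?.
  have ? : 0 <= \1_A w :> R := indic_ge0 A w.
  have [/ltail ?|wN] := leP (eta n w) (x - N%:R); first lra.
  have [/rtail ?|Nw] := ltP (x + N%:R) (eta n w); first lra.
  rewrite indicE mem_set /=; first lra.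
  by rewrite /A /window /= wN natrD addrA subrK.
have := expectation_le_cst_indic (P n) (measurable_phi n (x + 1))
  (measurable_phi n x) (measurable_window n _ _) (phi_ge0 n _) (phi_ge0 n x)
  (ltW eps0) phi_le.
have := prob_window_le_nat n (x - N%:R) (N + N); rewrite -/A.
rewrite !expected_phiE -(fineK (fin_num_measure (P n) _ (measurable_window n _ _))).
by rewrite -!EFinD !lee_fin; lra.
Qed.

Lemma cdf_gap_sup_le_window_sup {eps : R} : 0 < eps -> exists K : R, 0 <= K /\
  forall n, (cdf_gap_sup n <= (eps + K * fine (window_sup n))%:E)%E.
Proof.
move=> eps0; have [N [_ ltail]] := phi_tails_nat eps0.
exists N%:R; split => // n; apply/ereal_supP => _ [x _ <-].
set A := window n (x - N%:R) (x - N%:R + N%:R).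
set B := [set w | eta n w <= x].
have indic_le w : \1_B w <= phi n x w + eps + \1_A w.
  case/andP: (phi_ge0_le1 n x w) => ? ?.
  have ? : 0 <= \1_A w :> R := indic_ge0 A w.
  have ? : \1_B w <= 1 :> R := indic_le1 B w.
  have [/ltail ?|wN] := leP (eta n w) (x - N%:R); first lra.
  have [wx|xw] := leP (eta n w) x.
    rewrite [\1_A w]indicE mem_set /=; first lra.
    by rewrite /A /window /= wN subrK.
  rewrite [\1_B w]indicE memNset /=; first lra.
  by rewrite /B /= => /(lt_le_trans xw); rewrite ltxx.
have := expectation_le_cst_indic (P n) (measurable_indic (measurable_RV_le _ (eta n) x))
  (measurable_phi n x) (measurable_window n _ _) (indic_ge0 B) (phi_ge0 n x)
  (ltW eps0) indic_le.
rewrite expectation_indic ?expected_phiE; last exact: measurable_RV_le.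
have := prob_window_le_nat n (x - N%:R) N; rewrite -/A.
rewrite -(fineK (fin_num_measure (P n) _ (measurable_window n _ _))).
rewrite -(fineK (fin_num_measure (P n) _ (measurable_RV_le _ (eta n) x))).
by rewrite -EFinB -!EFinD !lee_fin; lra.
Qed.

Lemma cdf_gap_sup_ge (eps : R) n : 0 < eps -> ((- eps)%:E <= cdf_gap_sup n)%E.
Proof.
move=> eps0; have eps20 : 0 < eps / 2 by rewrite divr_gt0.
have [M [_ rtail]] := phi_right_tail _ eps20.
have [y Py] := exists_cdf_le _ (eta n) eps20.
set B := [set w | eta n w <= y].
have phi_le w : phi n (y - M) w <= cst 0 w + eps / 2 + \1_B w.
  have ? : 0 <= \1_B w :> R := indic_ge0 B w.
  have [wy|yw] := leP (eta n w) y.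
    case/andP: (phi_ge0_le1 n (y - M) w) => _ ?.
    by rewrite [\1_B w]indicE mem_set //=; lra.
  have : phi n (y - M) w < eps / 2 by apply: rtail; lra.
  by rewrite /=; lra.
have := expectation_le_cst_indic (P n) (measurable_phi n (y - M))
  (measurable_cst (0 : R)) (measurable_RV_le _ (eta n) y) (phi_ge0 n _) (fun=> lexx 0)
  (ltW eps20) phi_le.
rewrite expectation_cst expected_phiE add0e => FP.
apply: le_trans (ereal_sup_ubound (ex_intro2 _ _ (y - M) I erefl)) => /=.
apply: le_trans (leeDr _ (measure_ge0 _ _)).
rewrite lee_fin lerN2 -lee_fin.
apply: le_trans FP (le_trans (leeD2l _ Py) _).
by rewrite -EFinD lee_fin; lra.
Qed.

Lemma increment_sup_cvg0 :
  window_sup @ \oo --> 0%E -> increment_sup @ \oo --> 0%E.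
Proof.
move=> /fine_cvg S0; apply: cvge0_eps_dominated S0 _ => eps eps0.
have [K [K0 DK]] := increment_sup_le_window_sup eps0.
exists K; split => // n; split; last exact: DK.
by apply: le_trans (increment_sup_ge0_le1 n).1; rewrite lee_fin oppr_le0 ltW.
Qed.

Lemma cdf_gap_sup_cvg0 :
  window_sup @ \oo --> 0%E -> cdf_gap_sup @ \oo --> 0%E.
Proof.
move=> /fine_cvg S0; apply: cvge0_eps_dominated S0 _ => eps eps0.
have [K [K0 GK]] := cdf_gap_sup_le_window_sup eps0.
by exists K; split => // n; split; [exact: cdf_gap_sup_ge | exact: GK].
Qed.

Context {c : R}.
Hypothesis c_gt0 : 0 < c.
Hypothesis phi_increment : forall n (x : R) (w : T n), x < eta n w <= x + 1 ->
  phi n (x + 1) w - phi n x w >= c.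

Lemma window_sup_le_increment_sup n :
  (window_sup n <= (c^-1 * fine (increment_sup n))%:E)%E.
Proof.
apply/ereal_supP => _ [x _ <-].
set A := window n x (x + 1).
have phi_ge w : phi n x w + c * \1_A w <= phi n (x + 1) w.
  have [_ [mono _]] := phi_mono n x (x + 1) w ltac:(lra).
  rewrite indicE; have [/[!inE]/phi_increment|] := boolP (w \in A).
    by rewrite mulr1; lra.
  by rewrite mulr0 addr0.
have := expectation_ge_indicZ (P n) (measurable_phi n (x + 1))
  (measurable_phi n x) (measurable_window n x (x + 1)) (phi_ge0 n x) (ltW c_gt0)
  phi_ge.
have : ((expected_phi n (x + 1) - expected_phi n x)%:E <= increment_sup n)%E.
  by apply: ereal_sup_ubound; exists x.
rewrite !expected_phiE increment_supE.
rewrite -(fineK (fin_num_measure (P n) _ (measurable_window n _ _))).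
rewrite -EFinM -EFinD !lee_fin => Dge Fge.
by rewrite ler_pdivlMl // mulrC; lra.
Qed.

Lemma window_sup_cvg0 :
  increment_sup @ \oo --> 0%E -> window_sup @ \oo --> 0%E.
Proof.
move=> /fine_cvg D0; apply: cvge0_eps_dominated D0 _ => eps eps0.
exists c^-1; split; first by rewrite invr_ge0 ltW.
move=> n; split; last first.
  by apply: le_trans (window_sup_le_increment_sup n) _; rewrite lee_fin lerDr ltW.
by apply: le_trans (window_sup_ge0_le1 n).1; rewrite lee_fin oppr_le0 ltW.
Qed.

End spreading.

Theorem proposition5p3 (R : realType) (d : nat -> measure_display)
  (T : forall n, measurableType (d n)) (P : forall n, probability (T n) R)
  (eta : forall n, {RV (P n) >-> R})
  (phi : forall n, R -> {RV (P n) >-> R}) :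
  (forall n (x y : R) (w : T n), x <= y ->
     0 <= phi n x w /\ phi n x w <= phi n y w /\ phi n y w <= 1) ->
  (forall eps : R, 0 < eps -> exists M : R, 0 < M /\
     forall n (x : R) (w : T n), eta n w - x > M -> phi n x w < eps) ->
  (forall eps : R, 0 < eps -> exists M : R, 0 < M /\
     forall n (x : R) (w : T n), eta n w - x < - M -> phi n x w > 1 - eps) ->
  (exists c : R, 0 < c /\
     forall n (x : R) (w : T n), x < eta n w <= x + 1 ->
       phi n (x + 1) w - phi n x w >= c) ->
  asymp_equiv_rv_fun P (fun n => eta n)
    (fun n x => fine ('E_(P n)[phi n x])%E).
Proof.
move=> mono rtail ltail [c [c0 incr]]; split; first split.
- exact: increment_sup_cvg0 mono rtail ltail.
- by move=> /(window_sup_cvg0 mono c0 incr).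
- by move=> S0 _; exact: cdf_gap_sup_cvg0 mono rtail ltail S0.
Qed.
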